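(* Let $K$ be a field, let $S=K[x_1,\dots,x_n]$ be the standard graded polynomial ring, and let $\mathfrak{m}=(x_1,\dots,x_n)$. Let $I\subset S$ be an ideal with $\mathfrak{m}\in\mathrm{Ass}(I)$. Then $I^{(k)}=I^k$ for all $k\ge1$.
   Context: $\mathrm{Ass}(I)$ is the set of associated prime ideals of $I$ (that is, of $S/I$), and the $k$th symbolic power of $I$ is $I^{(k)}=\bigcap_{P\in\mathrm{Ass}(I)}(I^kS_P\cap S)$.
   Formalization: The ideal I is assumed homogeneous; for arbitrary ideals the claim fails, e.g. I = (ab, bc, ca) ∩ (x,y,z) in K[x,y,z] with a = x−1, b = y−1, c = z−1, where abc·x² lies in I^(2) but not in I^2. *)

(* Defs.v *)
From mathcomp Require Import all_boot all_order all_algebra.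
From mathcomp Require Import fraction.
From mathcomp Require Import boolp classical_sets.
From mathcomp Require Import mpoly.

Set Implicit Arguments.
Unset Strict Implicit.
Unset Printing Implicit Defensive.

Import GRing.Theory.
Local Open Scope ring_scope.
Local Open Scope classical_set_scope.

(* M is an ideal of A, where A is meant to be a subring of T; taking A = setT
   gives the ideals of T itself. *)
Definition ideal_of (T : comNzRingType) (A M : set T) : Prop :=
  [/\ M `<=` A, M 0,
      forall x y, M x -> M y -> M (x + y)
    & forall a x, A a -> M x -> M (a * x)].

Definition ideal_gen (T : comNzRingType) (A G : set T) : set T :=
  smallest (ideal_of A) G.

Definition is_ideal (T : comNzRingType) (I : set T) : Prop :=
  ideal_of setT I.

Definition ideal_mul (T : comNzRingType) (I J : set T) : set T :=
  ideal_gen setT [set x * y | x in I & y in J].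

Fixpoint ideal_exp (T : comNzRingType) (I : set T) (k : nat) : set T :=
  if k is k'.+1 then ideal_mul I (ideal_exp I k') else setT.

Definition is_prime_ideal (T : comNzRingType) (P : set T) : Prop :=
  [/\ is_ideal P, ~ P 1 & forall x y, P (x * y) -> P x \/ P y].

(* The annihilator of the class of f in T / I is {g | g * f \in I}. *)
Definition Ass (T : comNzRingType) (I : set T) : set (set T) :=
  [set P | is_prime_ideal P /\ exists f, P = [set g | I (g * f)]].

(* For a domain R, the localization R_P is realized as a subring of the
   fraction field of R. *)
Definition localization (R : idomainType) (P : set R) : set {fraction R} :=
  [set tofrac a / tofrac s | a in setT & s in ~` P].

(* J R_P, the ideal of R_P generated by the image of J. *)
Definition loc_extension (R : idomainType) (P J : set R) : set {fraction R} :=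
  ideal_gen (localization P) (@tofrac R @` J).

Definition symbolic_power (R : idomainType) (I : set R) (k : nat) : set R :=
  \bigcap_(P in Ass I) (@tofrac R @^-1` loc_extension P (ideal_exp I k)).

Definition irrelevant_ideal (K : fieldType) (n : nat) : set {mpoly K[n]} :=
  ideal_gen setT [set 'X_i | i in [set: 'I_n]].

(* I contains all the homogeneous components of its elements, with respect to
   the standard grading. *)
Definition is_homogeneous (K : fieldType) (n : nat) (I : set {mpoly K[n]}) :
    Prop :=
  forall (f : {mpoly K[n]}) (d : nat), I f -> I (pihomog mdeg d f).

(* Main.v *)
Require Import Defs.
From mathcomp Require Import all_boot all_order all_algebra.
From mathcomp Require Import fraction.
From mathcomp Require Import boolp classical_sets.
From mathcomp Require Import mpoly.

(** Since the irrelevant ideal m is itself an associated prime of I, the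
    symbolic power of I is contained in the contraction of the extension of
    [I^k] to the local ring at m; conversely [I^k] lies in each of the
    intersected contractions. So the theorem amounts to saying that extending
    [I^k] to the local ring at m and contracting it back creates nothing new.

    An element f of that contraction satisfies [s * f] in [I^k] for some s
    outside m ([loc_extension_contract]). Every polynomial without constant
    term lies in m ([irrelevant_ideal_mcoeff0]), hence s has a nonzero constant
    term c. The ideal [I^k] is homogeneous because I is
    ([homogeneous_ideal_exp]), so each component
      [(s * f)_d = c f_d + \sum_(0 < i <= d) s_i f_(d - i)]
    lies in it; by strong induction on d all the components [f_d] lie in [I^k],
    and so does f, which is their sum ([homogeneous_ideal_cancel]). *)

Set Implicit Arguments.
Unset Strict Implicit.
Unset Printing Implicit Defensive.

Import GRing.Theory.

Section Ideals.
Local Open Scope ring_scope.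
Local Open Scope classical_set_scope.

Lemma ideal_sum (T : comNzRingType) (A M : set T) (idM : ideal_of A M)
    (J : Type) (r : seq J) (P : pred J) (F : J -> T) :
  (forall j, P j -> M (F j)) -> M (\sum_(j <- r | P j) F j).
Proof. by case: idM => _ M0 MD _ MF; apply: big_ind. Qed.

Lemma ideal_of_refl (T : comNzRingType) (A : set T) :
  A 0 -> (forall x y, A x -> A y -> A (x + y)) ->
  (forall x y, A x -> A y -> A (x * y)) -> ideal_of A A.
Proof. by move=> A0 AD AM; split. Qed.

Lemma ideal_gen_ideal (T : comNzRingType) (A G : set T) :
  ideal_of A A -> G `<=` A -> ideal_of A (ideal_gen A G).
Proof.
move=> idA GA; split.
- by move=> x; apply.
- by move=> M [[]].
- move=> x y Gx Gy M MG; have [[_ _ MD _] _] := MG.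
  by apply: MD; [exact: Gx|exact: Gy].
- move=> a x Aa Gx M MG; have [[_ _ _ MM] _] := MG.
  by apply: MM => //; exact: Gx.
Qed.

Lemma ideal_gen_is_ideal (T : comNzRingType) (G : set T) :
  is_ideal (ideal_gen setT G).
Proof. by apply: ideal_gen_ideal => //; apply: ideal_of_refl. Qed.

Lemma ideal_exp_is_ideal (T : comNzRingType) (I : set T) (k : nat) :
  is_ideal (ideal_exp I k).
Proof. by case: k => [|k]; [exact: ideal_of_refl|exact: ideal_gen_is_ideal]. Qed.

(** The fractions [a / s] with a in J and s outside P already form an ideal of
    the localization (common denominators exist because P is prime), so they
    exhaust the extension of J; clear denominators in [f = a / s]. *)
Lemma loc_extension_contract (R : idomainType) (P J : set R) (f : R) :
  is_prime_ideal P -> is_ideal J -> loc_extension P J (tofrac f) ->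
  exists2 s, ~ P s & J (s * f).
Proof.
move=> [[_ P0 _ _] P1 PM] [_ J0 JD JM].
have PMC s t : ~ P s -> ~ P t -> ~ P (s * t) by move=> ? ? /PM[].
have PC0 s : ~ P s -> (tofrac s != 0).
  by move=> Ps; rewrite tofrac_eq0; apply: contra_notN Ps => /eqP->.
pose N := [set tofrac a / tofrac s | a in J & s in ~` P] : set {fraction R}.
have idN : ideal_of (localization P) N.
  split.
  - by move=> _ [a Ja [s Ps <-]]; exists a => //; exists s.
  - by exists 0 => //; exists 1; rewrite // tofrac0 mul0r.
  - move=> _ _ [a Ja [s Ps <-]] [b Jb [t Pt <-]].
    exists (t * a + s * b); first by apply: JD; apply: JM.
    exists (s * t); first exact: PMC.
    rewrite addf_div ?PC0 // tofracD !tofracM.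
    by congr ((_ + _) / _); rewrite mulrC.
  - move=> _ _ [a _ [s Ps <-]] [b Jb [t Pt <-]].
    exists (a * b); first exact: JM.
    by exists (s * t); [exact: PMC|rewrite !tofracM mulf_div].
have JN : @tofrac R @` J `<=` N.
  by move=> _ [a Ja <-]; exists a => //; exists 1; rewrite // tofrac1 divr1.
move=> /(_ N (conj idN JN)) [a Ja [s Ps afs]]; exists s => //.
suff -> : s * f = a by [].
by apply/eqP; rewrite -tofrac_eq tofracM -afs mulrC divfK ?PC0.
Qed.

Lemma ideal_exp_sub_symbolic_power (R : idomainType) (I : set R) (k : nat) :
  ideal_exp I k `<=` symbolic_power I k.
Proof. by move=> f If P _; apply: sub_gen_smallest; exists f. Qed.

End Ideals.

Section Components.
Local Open Scope ring_scope.
Local Open Scope classical_set_scope.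
Variables (K : fieldType) (n : nat).
Implicit Types (f g s : {mpoly K[n]}) (I J : set {mpoly K[n]}).

Lemma pihomogM d f g :
  pihomog mdeg d (f * g) =
    \sum_(i < d.+1) pihomog mdeg i f * pihomog mdeg (d - i) g.
Proof.
(* one bound for both decompositions, exceeding d so that every component
   appearing in the formula is among the summands *)
pose k := maxn d.+1 (maxn (msize f) (msize g)).
have fk : (msize f <= k)%N by rewrite !leq_max leqnn orbT.
have gk : (msize g <= k)%N by rewrite !leq_max leqnn !orbT.
have dk : (d.+1 <= k)%N by rewrite leq_max leqnn.
rewrite {1}(pihomog_partitionE fk) {1}(pihomog_partitionE gk).
rewrite mulr_suml linear_sum [RHS](big_ord_widen k
  (fun i => pihomog mdeg i f * pihomog mdeg (d - i) g) dk) [RHS]big_mkcond /=.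
apply: eq_bigr => i _; rewrite mulr_sumr linear_sum /=.
have hom j : pihomog mdeg i f * pihomog mdeg j g \is (i + j)%N.-homog for mdeg.
  by apply: dhomogM; exact: pihomogP.
case: ltnP => [id|di]; last first.
  apply: big1 => j _; apply: (pihomog_ne0 _ (hom j)).
  by rewrite gtn_eqF // (leq_trans di) // leq_addr.
have jk : (d - i < k)%N by rewrite (leq_trans _ dk) // ltnS leq_subr.
rewrite (bigD1 (Ordinal jk)) //= big1 ?addr0 => [|j /eqP ne].
  by apply: pihomog_dE; have := hom (d - i)%N; rewrite subnKC.
apply: (pihomog_ne0 _ (hom j)); apply/eqP => ijd; apply: ne.
by apply: val_inj; rewrite /= -ijd addKn.
Qed.

Lemma pihomog0E f : pihomog mdeg 0 f = (f@_0)%:MP.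
Proof.
have fk : (msize f <= (msize f).+1)%N by [].
rewrite (pihomogwE _ _ fk).
have m0 : (mdeg (0%MM : 'X_{1..n}) < (msize f).+1)%N by rewrite mdeg0.
rewrite (big_pred1 (BMultinom m0)) /=; first by rewrite mpolyX0 alg_mpolyC.
by move=> m /=; rewrite mdeg_eq0 -val_eqE.
Qed.

(** Each monomial other than 1 is a multiple of some variable. *)
Lemma irrelevant_ideal_mcoeff0 s : s@_0 = 0 -> @irrelevant_ideal K n s.
Proof.
move=> s0; rewrite [s]mpolyE.
have idm : is_ideal (@irrelevant_ideal K n) by exact: ideal_gen_is_ideal.
apply: (ideal_sum idm) => m _; have [_ m0 _ mM] := idm.
have [->|/eqP mN0] := eqVneq m 0%MM; first by rewrite s0 scale0r.
have /existsP [i mi] : [exists i, m i != 0%N].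
  apply: contra_notT mN0 => /existsPn mE; apply/mnmP => i.
  by rewrite mnm0E; apply/eqP; rewrite -[_ == _]negbK mE.
rewrite -(submK (m := U_(i)) (m' := m)) ?lep1mP // mpolyXD scalerAl.
by apply: mM => //; apply: sub_gen_smallest; exists i.
Qed.

(** The elements all of whose components lie in [I J] form an ideal, and by the
    product formula it contains the products that generate [I J]. *)
Lemma homogeneous_ideal_mul I J :
  is_homogeneous I -> is_homogeneous J -> is_homogeneous (ideal_mul I J).
Proof.
move=> hI hJ f d IJf.
have idIJ : is_ideal (ideal_mul I J) by exact: ideal_gen_is_ideal.
have [_ IJ0 IJD IJM] := idIJ.
pose N := [set f : {mpoly K[n]} | forall d, ideal_mul I J (pihomog mdeg d f)].
suff /(_ f IJf d) : ideal_mul I J `<=` N by [].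
apply: smallest_sub.
  split=> // [e|x y Nx Ny e|a x _ Nx e].
  - by rewrite pihomog0.
  - by rewrite pihomogD; exact: IJD.
  - by rewrite pihomogM; apply: (ideal_sum idIJ) => i _; exact: IJM.
move=> _ [x Ix [y Jy <-]] e; rewrite pihomogM.
apply: (ideal_sum idIJ) => i _; apply: sub_gen_smallest.
exists (pihomog mdeg i x); first exact: hI.
by exists (pihomog mdeg (e - i) y); first exact: hJ.
Qed.

Lemma homogeneous_ideal_exp I k :
  is_homogeneous I -> is_homogeneous (ideal_exp I k).
Proof. by move=> hI; elim: k => //= k; exact: homogeneous_ideal_mul. Qed.

(** A polynomial with nonzero constant term is a nonzerodivisor modulo any
    homogeneous ideal: the lowest component of f not in J would be, up to the
    unit [s@_0], the lowest component of [s * f] not in J. *)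
Lemma homogeneous_ideal_cancel J s f :
  is_ideal J -> is_homogeneous J -> s@_0 != 0 -> J (s * f) -> J f.
Proof.
move=> idJ hJ s0 Jsf; have [_ J0 JD JM] := idJ.
suff Jf d : J (pihomog mdeg d f).
  by rewrite (pihomog_partitionE (leqnn (msize f))); exact: (ideal_sum idJ).
elim/ltn_ind: d => d IHd; have := hJ _ d Jsf.
rewrite pihomogM big_ord_recl subn0 pihomog0E.
set r := \sum_(i < d) _ => Jfr.
have Jr : J r.
  apply: (ideal_sum idJ) => i _; apply: JM => //; apply: IHd.
  by rewrite lift0 ltn_subrL (leq_ltn_trans _ (ltn_ord i)).
(* solve c f_d + r for f_d, the constant c being a unit *)
have -> : pihomog mdeg d f =
    ((s@_0)^-1)%:MP * ((s@_0)%:MP * pihomog mdeg d f + r + (-1) * r).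
  by rewrite mulN1r addrK mulrA -mpolyCM mulVf // mul1r.
by apply: (JM) => //; apply: JD => //; exact: JM.
Qed.

End Components.

Theorem lemma5p6 (K : fieldType) (n : nat) (I : set {mpoly K[n]})
    (I_ideal : is_ideal I) (I_homog : is_homogeneous I)
    (m_Ass : Ass I (@irrelevant_ideal K n)) :
  forall k : nat, 1 <= k -> symbolic_power I k = ideal_exp I k.
Proof.
move=> k _; apply/seteqP; split; last exact: ideal_exp_sub_symbolic_power.
move=> f /(_ _ m_Ass) /= fm.
have idIk := ideal_exp_is_ideal I k.
have [s ms Isf] := loc_extension_contract m_Ass.1 idIk fm.
apply: (homogeneous_ideal_cancel idIk _ _ Isf).
  exact: homogeneous_ideal_exp.
by apply: contra_notN ms => /eqP; exact: irrelevant_ideal_mcoeff0.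
Qed.
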